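(* Let $b \ge 2$ be an integer and let $b_{1}<b_{2}<\cdots$ be all the elements of $\mathfrak{D}_{b}$ in increasing order. For every positive integer $N$ there exists $\gamma_{N} \in \mathbb{R}$ such that $$\min_{1 \leq n \leq N}\|\gamma_{N} b_{n}\| \geq \frac{1}{b^4}\,N^{- \frac{\log_{2} b}{b-1}}.$$
   Context: For $x \in \mathbb{R}$, $\|x\|$ denotes the distance from $x$ to the nearest integer. For an integer $b \ge 2$, $$\mathfrak{D}_{b} := \left\{\sum_{d=0}^{\infty}a_{d}b^{d}: a_{d}\in \{0,1\},\ 0<\sum_{d=0}^{\infty}a_{d}<\infty\right\},$$ i.e. the set of positive integers whose base-$b$ digits all lie in $\{0,1\}$. $\log_2$ is the logarithm to base $2$. *)

(* Defs.v *)
From HB Require Import structures.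
From mathcomp Require Import all_boot all_order all_algebra.
From mathcomp Require Import all_classical all_reals all_analysis.
Set Implicit Arguments.
Unset Strict Implicit.
Unset Printing Implicit Defensive.
Import Order.TTheory GRing.Theory Num.Theory.

Local Open Scope classical_set_scope.
Local Open Scope ring_scope.

Definition nearest_int_dist (R : realType) (x : R) : R :=
  inf [set `|x - m%:~R| | m in [set: int]].

Definition log2 (R : realType) (x : R) : R := ln x / ln 2.

(* The sums are finitely supported sums over all of nat; such a sum is 0 by
   convention when its support is infinite, so the condition that the digit sum
   is finite is stated separately. *)
Definition digits01 (b : nat) : set nat :=
  [set k | exists a : nat -> nat,
     [/\ range a `<=` [set 0%N; 1%N],
         finite_set [set d | a d <> 0%N],
         (0 < \sum_(d \in [set: nat]) a d)%N
       & k = \sum_(d \in [set: nat]) (a d * b ^ d)%N]].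

(* Only the values of [u] at positive indices matter: the enumeration is
   u 1 < u 2 < ..., and u 0 is arbitrary. *)
Definition increasing_enumeration (A : set nat) (u : nat -> nat) : Prop :=
  (forall m n : nat, (0 < m)%N -> (m < n)%N -> (u m < u n)%N) /\
  u @` [set n | (0 < n)%N] = A.

(* F 1 is the initial value of the iterated minimum because min has no neutral
   element on R; for 0 < N it is one of the terms, so this is the minimum of
   F 1, ..., F N. *)
Definition min_upto (R : realType) (N : nat) (F : nat -> R) : R :=
  \big[Num.min/F 1%N]_(1 <= n < N.+1) F n.

(* Main.v *)
Require Import Defs.
From mathcomp Require Import all_boot all_order all_algebra.
From mathcomp Require Import all_classical all_reals all_analysis.
From mathcomp Require Import zify ring lra.
Import Order.TTheory GRing.Theory Num.Theory.
Local Open Scope ring_scope.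

(** The multiplier [gamma] is a sum of [b - 1] equally spaced negative powers of
    [b], and the spacing [g] is chosen so that all of [b_1, ..., b_N] lie below
    [b ^ ((b - 1) g)]:
    [[
      gamma = b^-g + b^-2g + ... + b^-(b-1)g.
    ]]
    Modulo 1, [gamma x] is the sum [F] of the numbers [(x mod b^(jg)) / b^(jg)]
    for [1 <= j <= b - 1].  The sum [F] itself stays away from 0 and from 1.

    - From below: if [0 < x < b^((b-1)g)] then some [x mod b^(jg)] is at least
      [b^((j-1)g)] ([exists_large_residue]), so [F >= b^-g].
    - From above: the digits of [x] are at most 1, so [x mod b^m] is at most
      [(b^m - 1) / (b - 1)] ([digits01_modn_lt]), each summand of [F] is at most
      [(1 - b^(-jg)) / (b - 1)], and there are exactly [b - 1] of them; hence
      [F <= 1 - b^-g / (b - 1) <= 1 - b^-(g+1)].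

    So [gamma x] is at distance at least [b^-(g+1)] from the integers
    ([nearest_int_dist_sparse]).

    How small can [g] be?  Reading the binary digits of [n] in base [b] is
    increasing and takes values in the enumerated set, so the [n]-th element of
    that set is at most the number obtained from [n], and [n < 2^k] gives
    [b_n < b^k] ([enumeration_digits01_lt]).  With [k] about [log2 N] one can
    take [g] about [log2 N / (b - 1)], and [b^-g] is then
    [N^(- log2 b / (b - 1))] up to a power of [b] ([exponent_bound]). *)

(** * Integers with digits 0 and 1 *)

(** The extreme case is all digits equal to 1, where the left-hand side is
    [b ^ n - 1]. *)
Lemma sum_digits01_lt (b : nat) (a : nat -> nat) (n : nat) :
  (1 < b)%N -> (forall i, a i <= 1)%N ->
  (b.-1 * (\sum_(i < n) a i * b ^ i) < b ^ n)%N.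
Proof.
move=> b1 a1; have bn0 : (0 < b ^ n)%N by rewrite expn_gt0; lia.
rewrite -(ltn_predK bn0) ltnS predn_exp leq_mul2l; apply/orP; right.
by apply: leq_sum => i _; rewrite -[leqRHS]mul1n leq_mul2r a1 orbT.
Qed.

Lemma fsbig_setT_ord (f : nat -> nat) (n : nat) :
  (forall i, (n <= i)%N -> f i = 0%N) ->
  \sum_(i \in [set: nat]) f i = \sum_(i < n) f i.
Proof.
move=> f0; rewrite fsbig_ord; apply/esym/fsbig_widen => // i [_ /= /negP].
by rewrite -leqNgt => /f0.
Qed.

(** Replaces the sums over all of [nat] by sums over an initial segment, and the
    condition on the digit sum by positivity of the number. *)
Lemma digits01P (b x : nat) : (1 < b)%N ->
  digits01 b x <->
  (0 < x)%N /\ exists (n : nat) (a : nat -> nat),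
    (forall i, a i <= 1)%N /\ x = (\sum_(i < n) a i * b ^ i)%N.
Proof.
move=> b1; have bi0 i : (0 < b ^ i)%N by rewrite expn_gt0; lia.
split=> [[a [a01 afin]]|[x0 [n [a [a1 xE]]]]].
  have [s sE] := (finite_seqP _).1 afin.
  pose n := (\max_(i <- s) i).+1.
  have a0 i : (n <= i)%N -> a i = 0%N.
    move=> ni; apply: contrapT => ai.
    have si : i \in s by have : [set` s]%classic i by rewrite -sE.
    by move: ni; rewrite /n ltnNge => /negP[]; apply: (@leq_bigmax_seq nat).
  rewrite (fsbig_setT_ord _ n)// (fsbig_setT_ord (fun d => a d * b ^ d)%N n); last first.
    by move=> i /a0 ->.
  move=> s0 ->; split; last first.
    exists n, a; split=> // i.
    by have [->|->] : [set 0%N; 1%N]%classic (a i) by apply: a01; exists i.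
  apply: leq_trans s0 _; apply: leq_sum => i _.
  by rewrite -[leqLHS]muln1 leq_mul2l bi0 orbT.
(* The digits from position n on do not contribute to x and must be erased. *)
pose a' i := if (i < n)%N then a i else 0%N.
have a'0 i : (n <= i)%N -> a' i = 0%N by rewrite /a' ltnNge => ->.
have xE' : x = (\sum_(i < n) a' i * b ^ i)%N.
  by rewrite xE; apply: eq_bigr => i _; rewrite /a' ltn_ord.
exists a'; split.
- move=> _ [i _ <-]; rewrite /a'; case: ifP => _; last by left.
  by have := a1 i; case: (a i) => [|[|//]] _; [left|right].
- apply: (sub_finite_set _ (finite_II n)) => i /= ai.
  by rewrite ltnNge; apply/negP => /a'0.
- rewrite (fsbig_setT_ord _ n)// lt0n; apply: contraTneq x0 => s0.
  rewrite xE' big1// => i _; move/eqP: s0; rewrite sum_nat_eq0.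
  by move=> /forallP/(_ i)/= /eqP ->.
- by rewrite (fsbig_setT_ord (fun d => a' d * b ^ d)%N n)// => i /a'0 ->.
Qed.

(** Reducing modulo [b ^ m] keeps the lowest [m] digits, which are still at
    most 1, so [sum_digits01_lt] applies to what remains. *)
Lemma digits01_modn_lt (b x m : nat) : (1 < b)%N -> digits01 b x ->
  (b.-1 * (x %% b ^ m) < b ^ m)%N.
Proof.
move=> b1 /(digits01P _ _ b1)[_ [n [a [a1 ->]]]].
have [mn|/ltnW nm] := leqP m n; last first.
  apply: leq_ltn_trans (leq_trans (sum_digits01_lt b a n b1 a1) _).
    by rewrite leq_mul2l leq_mod orbT.
  by rewrite leq_exp2l.
rewrite -(big_mkord xpredT (fun i => a i * b ^ i)%N) (big_cat_nat _ mn)//=.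
have /eqP high0 : (b ^ m %| \sum_(m <= i < n) a i * b ^ i)%N.
  rewrite big_nat; apply: dvdn_sum => i /andP[mi _].
  by rewrite dvdn_mull// dvdn_exp2l.
rewrite -modnDmr high0 addn0 big_mkord.
apply: leq_ltn_trans (sum_digits01_lt b a m b1 a1).
by rewrite leq_mul2l leq_mod orbT.
Qed.

(** Take the [j] such that [x] lies between [b ^ (j * g)] and
    [b ^ (j.+1 * g)]: there the residue is [x] itself. *)
Lemma exists_large_residue (b g n x : nat) : (0 < x)%N ->
  (x < b ^ (n * g))%N ->
  exists2 j : nat, (j < n)%N & (b ^ (j * g) <= x %% b ^ (j.+1 * g))%N.
Proof.
move=> x0; elim: n => [|n IHn] xn; first by rewrite mul0n expn0 in xn; lia.
have [/IHn[j jn jx]|nx] := ltnP x (b ^ (n * g)); last first.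
  by exists n; rewrite ?modn_small.
by exists j => //; apply: ltnW.
Qed.

(** * Size of the elements of the enumeration *)

Definition binary_in_base (b k n : nat) : nat :=
  (\sum_(i < k) odd (n %/ 2 ^ i) * b ^ i)%N.

Lemma binary_in_base_recl (b k n : nat) :
  binary_in_base b k.+1 n = (odd n + b * binary_in_base b k n./2)%N.
Proof.
rewrite /binary_in_base big_ord_recl !expn0 divn1 muln1 big_distrr/=; congr addn.
apply: eq_bigr => i _; rewrite /bump/= add1n -divn2 -divnMA -expnS.
by rewrite [in LHS](expnS b) mulnCA.
Qed.

Lemma ltn_binary_in_base (b k m n : nat) : (1 < b)%N -> (m < n)%N -> (n < 2 ^ k)%N ->
  (binary_in_base b k m < binary_in_base b k n)%N.
Proof.
move=> b1; elim: k m n => [|k IHk] m n mn; first by rewrite expn0; lia.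
rewrite expnS => nk; rewrite !binary_in_base_recl.
have [mn2|nm2] := ltnP m./2 n./2; last first.
  (* Equal halves and m < n force m even and n odd. *)
  by rewrite (_ : m./2 = n./2); lia.
have /(IHk _ _ mn2) lt_binary_in_base : (n./2 < 2 ^ k)%N by lia.
(* The gain of b in the higher digits outweighs the loss of 1 in the lowest. *)
by nia.
Qed.

Lemma binary_in_base_lt (b k n : nat) : (1 < b)%N -> (binary_in_base b k n < b ^ k)%N.
Proof.
move=> b1.
apply: leq_ltn_trans (sum_digits01_lt b (fun i => odd (n %/ 2 ^ i)) k b1 _).
  by rewrite leq_pmull//; lia.
by move=> i; case: odd.
Qed.

Lemma digits01_binary_in_base (b k n : nat) : (1 < b)%N -> (0 < n < 2 ^ k)%N ->
  digits01 b (binary_in_base b k n).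
Proof.
move=> b1 /andP[n0 nk]; apply/digits01P => //; split.
  by apply: leq_ltn_trans (ltn_binary_in_base _ _ _ _ b1 n0 nk).
by exists k, (fun i => odd (n %/ 2 ^ i)); split=> // i; case: odd.
Qed.

(** The increasing enumeration of a set of naturals is pointwise minimal among
    the increasing sequences in that set. If [v n.+1 = u c] with [c <= n], then
    [v n.+1 <= u n <= v n], against the monotonicity of [v]. *)
Lemma increasing_enumeration_le (A : set nat) (u v : nat -> nat) (n : nat) :
  increasing_enumeration A u ->
  (forall i, (0 < i <= n)%N -> A (v i)) ->
  (forall i j, (0 < i < j)%N -> (j <= n)%N -> (v i < v j)%N) ->
  (0 < n)%N -> (u n <= v n)%N.
Proof.
move=> [uincr uA]; elim: n => // n IHn vA vincr _.
have [c /= c0 uc] : (u @` [set n | (0 < n)%N])%classic (v n.+1).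
  by rewrite uA; apply: vA; lia.
have [cn|] := leqP c n; last first.
  rewrite leq_eqVlt => /orP[/eqP nc|nc]; first by rewrite -uc nc.
  by rewrite -uc ltnW// uincr.
have n0 : (0 < n)%N by apply: leq_trans cn.
have un : (u n <= v n)%N.
  apply: IHn n0 => [i i_n|i j ij jn]; first by apply: vA; lia.
  by apply: vincr; lia.
have vn : (v n < v n.+1)%N by apply: vincr; lia.
move: cn; rewrite leq_eqVlt => /orP[/eqP cn|/(uincr _ _ c0)]; last by lia.
by rewrite cn in uc; lia.
Qed.

Lemma enumeration_digits01_lt (b k n : nat) (bs : nat -> nat) : (1 < b)%N ->
  increasing_enumeration (digits01 b) bs -> (0 < n < 2 ^ k)%N ->
  (bs n < b ^ k)%N.
Proof.
move=> b1 hbs /andP[n0 nk]; apply: leq_ltn_trans (binary_in_base_lt b k n b1).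
apply: (increasing_enumeration_le _ _ (binary_in_base b k) n hbs) => // [i /andP[i0 i_n]|].
  by apply: digits01_binary_in_base => //; rewrite i0 (leq_ltn_trans i_n).
move=> i j /andP[_ ij] jn; apply: ltn_binary_in_base => //; exact: leq_ltn_trans nk.
Qed.

(** * The multiplier *)

Lemma nearest_int_dist_ge (R : realType) (m : int) (f d : R) :
  d <= f <= 1 - d -> d <= nearest_int_dist (m%:~R + f).
Proof.
move=> /andP[df fd]; apply: lb_le_inf => [|_ [p _ <-]]; first by exists `|m%:~R + f - 0%:~R|, 0.
rewrite (_ : _ - _ = (m - p)%:~R + f); last by rewrite intrB; lra.
case: (leP 0 (m - p)) => mp.
  have : 0 <= (m - p)%:~R :> R by rewrite ler0z.
  move=> mp0; apply: le_trans (ler_norm _); lra.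
have : (m - p)%:~R <= -1 :> R.
  by rewrite -[leRHS]/((-1)%:~R) ler_int; lia.
move=> mp1; rewrite -normrN; apply: le_trans (ler_norm _); lra.
Qed.

Lemma min_upto_ge (R : realType) (N : nat) (F : nat -> R) (d : R) : (0 < N)%N ->
  (forall n, (0 < n <= N)%N -> d <= F n) -> d <= min_upto N F.
Proof.
move=> N0 dF; rewrite /min_upto big_nat; apply: le_bigmin; first exact: dF.
by move=> n; rewrite ltnS; exact: dF.
Qed.

Definition sparse_gamma (R : realType) (b g : nat) : R :=
  \sum_(j < b.-1) (b%:R ^+ (j.+1 * g))^-1.

(** The lower bound on the fractional part comes from one large residue, the
    upper bound from the sum of the bounds on all of them. *)
Lemma nearest_int_dist_sparse (R : realType) (b g x : nat) : (1 < b)%N ->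
  digits01 b x -> (x < b ^ (b.-1 * g))%N ->
  (b%:R ^+ g.+1)^-1 <= nearest_int_dist (sparse_gamma R b g * x%:R).
Proof.
move=> b1 xD xlt; have [x0 _] := (digits01P _ _ b1).1 xD.
have br0 : 0 < b%:R :> R by rewrite ltr0n; lia.
have B0 : 0 < b.-1%:R :> R by rewrite ltr0n; lia.
have M0 i : 0 < b%:R ^+ i :> R by rewrite exprn_gt0.
pose r j := (x %% b ^ (j.+1 * g))%N%:R / b%:R ^+ (j.+1 * g) :> R.
have -> : sparse_gamma R b g * x%:R =
    (\sum_(j < b.-1) x %/ b ^ (j.+1 * g))%N%:~R + \sum_(j < b.-1) r j.
  rewrite -[_%:~R]/(_%:R) natr_sum -big_split /sparse_gamma mulr_suml/=.
  apply: eq_bigr => j _; rewrite {1}(divn_eq x (b ^ (j.+1 * g))) natrD natrM natrX.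
  by rewrite mulrC mulrDl mulfK// lt0r_neq0.
have r0 j : 0 <= r j by rewrite divr_ge0// ltW.
apply: nearest_int_dist_ge; apply/andP; split.
  have [j jb jx] := exists_large_residue _ _ _ _ x0 xlt.
  rewrite (bigD1 (Ordinal jb))//=.
  apply: le_trans (_ : r j <= _); last by rewrite lerDl sumr_ge0.
  apply: le_trans (_ : (b%:R ^+ g)^-1 <= _).
    by rewrite lef_pV2 ?posrE// exprS ler_peMl ?ler1n ?(ltnW b1)// ltW.
  rewrite /r ler_pdivlMr// mulSn exprD mulKf ?lt0r_neq0//.
  by rewrite -natrX ler_nat.
(* Dividing digits01_modn_lt by (b - 1) b^m; the subtracted term keeps F below 1. *)
have rle j : r j <= b.-1%:R^-1 - b.-1%:R^-1 * (b%:R ^+ (j.+1 * g))^-1.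
  have -> : b.-1%:R^-1 - b.-1%:R^-1 * (b%:R ^+ (j.+1 * g))^-1 =
      b.-1%:R^-1 * (b%:R ^+ (j.+1 * g) - 1) / b%:R ^+ (j.+1 * g) :> R.
    by field; rewrite !lt0r_neq0.
  rewrite /r ler_pM2r ?invr_gt0// ler_pdivlMl// lerBrDr -natrX -natrM natr1.
  by rewrite ler_nat digits01_modn_lt.
apply: (@le_trans _ _ (\sum_(j < b.-1)
  (b.-1%:R^-1 - b.-1%:R^-1 * (b%:R ^+ (j.+1 * g))^-1))).
  by apply: ler_sum => j _; exact: rle.
rewrite sumrB -mulr_sumr sumr_const card_ord -[_^-1 *+ _]mulr_natr mulVf ?lt0r_neq0//.
(* Only the largest of the subtracted terms, j = 0, is kept. *)
have b1' : (0 < b.-1)%N by lia.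
rewrite lerD2l lerN2 exprS invfM ler_pM ?invr_ge0 ?(ltW br0) ?(ltW (M0 g))//.
  by rewrite lef_pV2 ?posrE// ler_nat; lia.
by rewrite (bigD1 (Ordinal b1'))//= mul1n lerDl sumr_ge0.
Qed.

(** * Comparison of exponents *)

(** Taking logarithms, with [t] the integral part of log2 of [N] and [q] the
    quotient of [t + 1] by [b - 1], this is [q + 2 <= 4 + log2 N / (b - 1)]; it
    follows from [t <= log2 N] and [q <= (t + 1) / (b - 1) <= t / (b - 1) + 1]. *)
Lemma exponent_bound (R : realType) (b N : nat) : (1 < b)%N -> (0 < N)%N ->
  1 / b%:R ^+ 4 * N%:R `^ (- (log2 (b%:R : R) / (b%:R - 1))) <=
    (b%:R ^+ ((trunc_log 2 N).+1 %/ b.-1).+2)^-1.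
Proof.
move=> b1 N0; set t := trunc_log 2 N; set q := (t.+1 %/ b.-1)%N.
have br0 : 0 < b%:R :> R by rewrite ltr0n; lia.
have Nr0 : 0 < N%:R :> R by rewrite ltr0n.
have L0 : 0 < ln b%:R :> R by rewrite ln_gt0 // ltr1n.
have l0 : 0 < ln 2 :> R by rewrite ln_gt0 // ltr1n.
have tN : t%:R * ln 2 <= ln N%:R :> R.
  rewrite mulr_natl -lnXn// ler_ln ?posrE ?exprn_gt0//.
  by rewrite -natrX ler_nat trunc_logP.
have qt : q%:R * b.-1%:R <= t%:R + 1 :> R.
  by rewrite natr1 -natrM ler_nat leq_divM.
have B1 : 1 <= b.-1%:R :> R by rewrite ler1n; lia.
rewrite (_ : b%:R - 1 = b.-1%:R); last by rewrite -(ltn_predK b1) -natr1 addrK.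
have bq0 : 0 < b%:R ^+ q.+2 :> R by exact: exprn_gt0.
have bN0 : 0 < b%:R ^+ 4 * N%:R `^ (log2 b%:R / b.-1%:R) :> R.
  by rewrite mulr_gt0 ?powR_gt0// exprn_gt0.
rewrite powRN div1r -invfM lef_pV2 ?posrE// -ler_ln ?posrE//.
rewrite lnXn// lnM ?posrE ?exprn_gt0 ?powR_gt0// lnXn// ln_powR /log2.
rewrite -[_ *+ q.+2]mulr_natr -[_ *+ 4]mulr_natr.
have -> : ln b%:R / ln 2 / b.-1%:R * ln N%:R =
    ln b%:R * (ln N%:R / ln 2 / b.-1%:R) :> R by field; rewrite !gt_eqF//; lra.
rewrite -mulrDr ler_pM2l//.
have tB : t%:R / b.-1%:R <= ln N%:R / ln 2 / b.-1%:R :> R.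
  by rewrite ler_pM2r ?invr_gt0; [rewrite ler_pdivlMr|lra].
have qB : q%:R <= t%:R / b.-1%:R + 1 :> R.
  have Bn0 : b.-1%:R != 0 :> R by rewrite gt_eqF//; lra.
  by rewrite -[X in _ + X](divff Bn0) -mulrDl ler_pdivlMr; lra.
rewrite -[q.+2%:R]natr1 -[q.+1%:R]natr1; lra.
Qed.

Theorem theorem1p2 (R : realType) (b : nat) (hb : (2 <= b)%N)
    (bs : nat -> nat) (hbs : increasing_enumeration (digits01 b) bs)
    (N : nat) (hN : (0 < N)%N) :
  exists gamma : R,
    min_upto N (fun n => nearest_int_dist (gamma * (bs n)%:R)) >=
      1 / b%:R ^+ 4 * N%:R `^ (- (log2 (b%:R : R) / (b%:R - 1))).
Proof.
(* N < 2 ^ k, and g is large enough for k <= (b - 1) g. *)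
pose k := (trunc_log 2 N).+1; pose g := (k %/ b.-1).+1.
exists (sparse_gamma R b g); apply: min_upto_ge => // n /andP[n0 nN].
have Nk : (N < 2 ^ k)%N by exact: trunc_log_ltn.
apply: le_trans (nearest_int_dist_sparse R b g _ hb _ _); first last.
- apply: leq_trans (enumeration_digits01_lt b k n bs hb hbs _) _.
    by rewrite n0 (leq_ltn_trans nN).
  by rewrite leq_exp2l// /g mulnC ltnW// ltn_ceil//; lia.
- by have [_ <-] := hbs; exists n.
exact: exponent_bound.
Qed.
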